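(* Let $d\ge 1$ be the feedback delay, $T\ge 0$ the horizon, and $\mathcal{R}$ the set of admissible rates. Let arbitrary past rates $\boldsymbol{r}_{-d}=[\ldots,r_{-d-1},r_{-d}]$ and corresponding degraded error-rate feedback $\hat{\boldsymbol{\epsilon}}_{-d}=[\ldots,\hat\epsilon_{-d-1},\hat\epsilon_{-d}]$ be given. Let $(r_t^* )_{t=0}^T$ be the optimal rate allocation under degraded feedback and $(r_t^{\mathrm{cg}})_{t=0}^T$ the causal-genie rate allocation under non-degraded feedback (both defined in the context). Then the expected total goodput of the former is no higher than that of the latter: $$\mathrm{E}\Big\{\sum_{t=0}^{T} G(r_t^*,\gamma_t)\,\Big|\,\hat{\boldsymbol{\epsilon}}_{-d},\boldsymbol{r}_{-d}\Big\}\;\le\;\mathrm{E}\Big\{\sum_{t=0}^{T} G(r_t^{\mathrm{cg}},\gamma_t)\,\Big|\,\hat{\boldsymbol{\epsilon}}_{-d},\boldsymbol{r}_{-d}\Big\}.$$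
   Context: Channel and goodput. Packets are indexed by integers $t$; the process is started at $t=-\infty$. The channel is a random SNR process $\{\gamma_t\}$ with $\gamma_t\in[0,\infty)$, which is exogenous: its law does not depend on the rates used. If rate $r\in\mathcal{R}\subset[0,\infty)$ is used when the SNR is $\gamma$, the packet error rate is a given function $\epsilon(r,\gamma)\in[0,1]$. For each $r\in\mathcal{R}$ the function $\gamma\mapsto\epsilon(r,\gamma)$ is monotonically (strictly) decreasing, so that $\gamma$ is uniquely determined by $r$ and $\epsilon(r,\gamma)$. The instantaneous goodput is $G(r,\gamma)=(1-\epsilon(r,\gamma))\,r$. Histories. Write $\epsilon_t=\epsilon(r_t,\gamma_t)$, where $r_t$ is the rate used at time $t$. Bold symbols denote entire histories: $\boldsymbol{r}_{s}=[\ldots,r_{s-1},r_{s}]$, $\boldsymbol{\gamma}_{s}=[\ldots,\gamma_{s-1},\gamma_{s}]$, $\boldsymbol{\epsilon}_{s}=[\ldots,\epsilon_{s-1},\epsilon_{s}]$, $\hat{\boldsymbol{\epsilon}}_{s}=[\ldots,\hat\epsilon_{s-1},\hat\epsilon_{s}]$. Since each $\gamma_k$ is determined by $(\epsilon_k,r_k)$, conditioning on $(\boldsymbol{\epsilon}_{s},\boldsymbol{r}_{s})$ determines $\boldsymbol{\gamma}_{s}$. Degraded feedback. $\hat\epsilon_t$ is a degraded (random) version of the error rate $\epsilon_t=\epsilon(r_t,\gamma_t)$ (for example, a Bernoulli($\epsilon_t$) ACK/NAK bit). At time $t$ the controller knows $\hat{\boldsymbol{\epsilon}}_{t-d}$ and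 the rates. Feedback and rates up to time $t-d$ carry no information about future SNRs beyond that in $\boldsymbol{\gamma}_{t-d}$: conditionally on $\boldsymbol{\gamma}_{t-d}$, the pair $(\hat{\boldsymbol{\epsilon}}_{t-d},\boldsymbol{r}_{t-d})$ is independent of $(\gamma_k)_{k>t-d}$. Consequently, for every fixed $r\in\mathcal{R}$, $$\mathrm{E}\{G(r,\gamma_t)\mid\hat{\boldsymbol{\epsilon}}_{t-d},\boldsymbol{\epsilon}_{t-d},\boldsymbol{r}_{t-d}\}=\mathrm{E}\{G(r,\gamma_t)\mid\boldsymbol{\epsilon}_{t-d},\boldsymbol{r}_{t-d}\}=\mathrm{E}\{G(r,\gamma_t)\mid\boldsymbol{\gamma}_{t-d}\}.$$ The feedback is called degraded when $\mathrm{E}\{G(r_t,\gamma_t)\mid\hat{\boldsymbol{\epsilon}}_{t-d},\boldsymbol{r}_{t-d}\}\ne\mathrm{E}\{G(r_t,\gamma_t)\mid\boldsymbol{\epsilon}_{t-d},\boldsymbol{r}_{t-d}\}$. Optimal allocation under degraded feedback. $r_t^*$ is a function of $(\hat{\boldsymbol{\epsilon}}_{t-d},\boldsymbol{r}_{t-d})$, defined by backward recursion for $t=T,T-1,\ldots,0$: $$r_t^*=\arg\max_{r_t\in\mathcal{R}}\mathrm{E}\Big\{G(r_t,\gamma_t)+\sum_{k=t+1}^{T}G(r_k^*,\gamma_k)\,\Big|\,\hat{\boldsymbol{\epsilon}}_{t-d},\boldsymbol{r}_{t-d}\Big\}.$$ The later rates $r_k^*$ are applied to the histories resulting from the choice of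 $r_t$, since the law of $\hat\epsilon_t$ depends on $r_t$. In the system run with this allocation the rates at times $t=0,\ldots,T$ are $r_t=r_t^*$, and the rates at negative times are arbitrary past rates. Causal genie. This is the same problem with non-degraded feedback $\boldsymbol{\epsilon}_{t-d}$ in place of $\hat{\boldsymbol{\epsilon}}_{t-d}$. Here $r_t^{\mathrm{cg}}$ is a function of $(\boldsymbol{\epsilon}_{t-d},\boldsymbol{r}_{t-d})$, equivalently of $\boldsymbol{\gamma}_{t-d}$: $$r_t^{\mathrm{cg}}=\arg\max_{r_t\in\mathcal{R}}\mathrm{E}\Big\{G(r_t,\gamma_t)+\sum_{k=t+1}^{T}G(r_k^{\mathrm{cg}},\gamma_k)\,\Big|\,\boldsymbol{\epsilon}_{t-d},\boldsymbol{r}_{t-d}\Big\},\qquad t=0,\ldots,T.$$ All maxima are assumed to be attained (by measurable selections), ties may be broken arbitrarily, and all expectations are assumed finite. (In)equalities between conditional expectations hold almost surely. *)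

(* Defs.v *)
From HB Require Import structures.
From mathcomp Require Import all_boot all_order all_algebra.
From mathcomp Require Import all_classical all_reals all_analysis.

Set Implicit Arguments.
Unset Strict Implicit.
Unset Printing Implicit Defensive.

Import Order.TTheory GRing.Theory Num.Theory.
Import numFieldNormedType.Exports.

Local Open Scope classical_set_scope.
Local Open Scope ring_scope.

(* One-sided infinite sequences [..., x_{s-1}, x_s], stored backwards from the
   present: h k is the entry k steps in the past. They carry the product
   sigma-algebra, generated by the coordinates. *)
Definition hist_cylinders (R : realType) : set (set (nat -> R)) :=
  [set C | exists (k : nat) (B : set R),
     measurable B /\ C = [set h : nat -> R | B (h k)]].

Definition hist (R : realType) := g_sigma_algebraType (@hist_cylinders R).

Section Conditioning.
Context {disp disp' : measure_display} {T : measurableType disp}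
  {U : measurableType disp'} {R : realType}.
Variables (P : probability T R) (H : T -> U).

(* g is a version of u |-> E{X | H = u}. *)
Definition is_cexp (X : T -> R) (g : U -> R) : Prop :=
  [/\ measurable_fun setT g,
      P.-integrable setT (EFin \o (g \o H)) &
      forall B : set U, measurable B ->
        (\int[P]_(w in H @^-1` B) (g (H w))%:E =
         \int[P]_(w in H @^-1` B) (X w)%:E)%E].

(* E{X | H}: a version picked by choice. For integrable X and measurable H one
   exists (Radon-Nikodym), and any two agree almost surely. *)
Definition cexp (X : T -> R) : T -> R :=
  (xget (cst 0 : {classic U -> R}) [set g : {classic U -> R} | is_cexp X g]
     : U -> R) \o H.

(* kappa is a regular conditional distribution of P given H. *)
Definition is_rcd (kappa : R.-pker U ~> T) : Prop :=
  forall (A : set T) (B : set U), measurable A -> measurable B ->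
    (\int[P]_(w in H @^-1` B) kappa (H w) A = P (A `&` H @^-1` B))%E.

End Conditioning.

(* Given Z, the random elements X and Y are independent. *)
Definition cond_indep {disp disp1 disp2 disp3 : measure_display}
    {T : measurableType disp} {U : measurableType disp1}
    {V : measurableType disp2} {W : measurableType disp3} {R : realType}
    (P : probability T R) (Z : T -> U) (X : T -> V) (Y : T -> W) : Prop :=
  forall (A : set V) (B : set W), measurable A -> measurable B ->
    {ae P, forall w,
      cexp P Z (\1_(X @^-1` A `&` Y @^-1` B)) w =
      cexp P Z (\1_(X @^-1` A)) w * cexp P Z (\1_(Y @^-1` B)) w}.

Section Link.
Context {disp : measure_display} {T : measurableType disp} {R : realType}.

(* Real-valued processes indexed by packets, from t = -oo on. *)
Definition process := int -> T -> R.

(* x_s = [..., x_{s-1}, x_s] *)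
Definition history (x : process) (s : int) (w : T) : hist R :=
  fun k : nat => x (s - k%:Z) w.

(* (x_k)_{k > s} *)
Definition future (x : process) (s : int) (w : T) : hist R :=
  fun k : nat => x (s + k.+1%:Z) w.

Definition goodput (eps : R -> R -> R) (r gam : R) : R := (1 - eps r gam) * r.

(* A feedback mechanism: fb t e w is what the receiver of packet t reports in
   outcome w if the error rate of that packet is e. The dependence on w is the
   degradation; the whole family indexed by e is needed because e depends on
   the rate that is chosen. *)
Definition feedback := int -> R -> T -> R.

Definition perfect_feedback : feedback := fun _ e _ => e.

(* The pair of feedback history and rate history up to time s. *)
Definition info (eps : R -> R -> R) (gam : process) (fb : feedback)
    (r : process) (s : int) (w : T) : hist R * hist R :=
  (history (fun t v => fb t (eps (r t v) (gam t v)) v) s w, history r s w).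

(* pol t gives the rate at time t >= 0 from the feedback and rates up to t-d. *)
Definition policy := nat -> hist R * hist R -> R.

Definition admissible (Rset : set R) (N : nat) (pol : policy) : Prop :=
  forall t : nat, (t <= N)%N ->
    measurable_fun setT (pol t) /\ (forall h, Rset (pol t h)).

Section ClosedLoop.
Variables (eps : R -> R -> R) (gam : process) (past : process) (d : nat).
Variable fb : feedback.

(* The rates when pol is applied at times 0, ..., n-1 to the histories that it
   generates itself; past supplies the rates at negative times. *)
Fixpoint run (pol : policy) (n : nat) : process :=
  if n is m.+1 then
    fun t w => if t == m%:Z
               then pol m (info eps gam fb (run pol m) (m%:Z - d%:Z) w)
               else run pol m t w
  else past.

(* As d >= 1, the rate at time t is settled after t+1 steps of run. *)
Definition rate (pol : policy) : process :=
  fun t w => run pol `|t|.+1 t w.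

(* Total goodput over the times t, ..., N. *)
Definition total_goodput (N : nat) (pol : policy) (t : nat) (w : T) : R :=
  \sum_(t <= k < N.+1) goodput eps (rate pol k%:Z w) (gam k%:Z w).

(* rho up to time t-d, then pol. *)
Definition switch (t : nat) (rho pol : policy) : policy :=
  fun j => if (j + d <= t)%N then rho j else pol j.

(* pol, except that the rate at time t is r. *)
Definition deviate (t : nat) (r : R) (pol : policy) : policy :=
  fun j => if j == t then cst r else pol j.

(* pol satisfies, for all t = N, ..., 0, the backward recursion
     r_t = argmax_{r in Rset} E{ G(r, gam_t) + sum_{k=t+1}^N G(r_k, gam_k) |
                                 feedback and rates up to t-d },
   where the later r_k act on the histories resulting from the choice of r.
   The recursion holds whatever rates were used up to t-d, not just on the
   path of pol: these come from an arbitrary admissible policy rho. Rates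
   strictly between t-d and t, which are not conditioned on, are those of the
   allocation itself. The maximum over r is taken pointwise in the history, for
   one regular version of the conditional expectation, so that no null set
   depends on r. *)
Definition optimal_allocation (P : probability T R) (Rset : set R) (N : nat)
    (pol : policy) : Prop :=
  admissible Rset N pol /\
  forall rho : policy, admissible Rset N rho ->
  forall t : nat, (t <= N)%N ->
    let sys := switch t rho pol in
    let H := info eps gam fb (rate sys) (t%:Z - d%:Z) in
    exists kappa : R.-pker (hist R * hist R)%type ~> T,
      is_rcd P H kappa /\
      {ae P, forall w, forall r : R, Rset r ->
        (\int[kappa (H w)]_v (total_goodput N (deviate t r sys) t v)%:E
         <= \int[kappa (H w)]_v (total_goodput N sys t v)%:E)%E}.

End ClosedLoop.

(* A policy on (error-rate, rate) histories which is a function of the SNR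
   history that they determine. *)
Definition function_of_snr (eps : R -> R -> R) (Rset : set R) (N : nat)
    (pol : policy) : Prop :=
  forall (t : nat) (x r r' : nat -> R), (t <= N)%N ->
    (forall k, 0 <= x k) -> (forall k, Rset (r k)) -> (forall k, Rset (r' k)) ->
    pol t (fun k => eps (r k) (x k), r) = pol t (fun k => eps (r' k) (x k), r').

End Link.

(* Main.v *)
Require Import Defs.
From HB Require Import structures.
From mathcomp Require Import all_boot all_order all_algebra.
From mathcomp Require Import all_classical all_reals all_analysis.
From mathcomp Require Import measurable_realfun zify.

(* The genie's rates are functions of the SNR history, so its choice at time t
   does not affect the later terms of its objective; these are nonnegative and
   integrable, hence cancel, and the genie's rate at time t maximizes
   E{G(r, gam_t) | H} over r, H being the genie's own information up to t-d.
   The sigma-algebra of H lies between that of the SNR history Z and that of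
   (I, Z), where I is the degraded information of the competing system (the past
   rates are part of I, and error rates determine SNRs by strict monotonicity).
   By conditional independence of I and the future given Z, a regular
   conditional distribution given H is therefore also one of gam_t given (I, Z).
   As the competing rate at time t is a function of I, integrating the pointwise
   optimality over events of I gives
   E{G(r*_t, gam_t) | I} <= E{G(rcg_t, gam_t) | I}, which is conditioned on the
   initial information and summed over t. *)

Set Implicit Arguments.
Unset Strict Implicit.
Unset Printing Implicit Defensive.

Import Order.TTheory GRing.Theory Num.Theory.
Import numFieldNormedType.Exports.

Local Open Scope classical_set_scope.
Local Open Scope ring_scope.

(** * Measures on products, densities, kernels and image measures *)

Lemma measurable_preimage d d' (T : measurableType d) (U : measurableType d')
    (f : T -> U) (A : set U) :
  measurable_fun setT f -> measurable A -> measurable (f @^-1` A).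
Proof. by move=> mf mA; rewrite -[X in measurable X]setTI; exact: mf. Qed.

(** Rectangles form a pi-system generating the product sigma-algebra; finiteness of [m1] lets the
    constant sequence [setT] serve as the exhaustion that uniqueness of measures asks for. *)
Lemma measure_prod_unique d1 d2 (T1 : measurableType d1)
    (T2 : measurableType d2) (R : realType)
    (m1 m2 : {measure set (T1 * T2) -> \bar R}) :
  (m1 setT < +oo)%E ->
  (forall A B, measurable A -> measurable B -> m1 (A `*` B) = m2 (A `*` B)) ->
  forall X, measurable X -> m1 X = m2 X.
Proof.
move=> m1oo m12 X mX.
pose C : set (set (T1 * T2)) := [set A `*` B | A in measurable & B in measurable].
apply: (measure_unique C (fun=> setT)) => //.
- by rewrite measurable_prod_measurableType.
- move=> _ _ [A1 mA1 [A2 mA2 <-]] [B1 mB1 [B2 mB2 <-]].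
  by exists (A1 `&` B1); [exact: measurableI|
     exists (A2 `&` B2); [exact: measurableI|rewrite setXI]].
- by move=> _; exists setT => //; exists setT => //; rewrite setXTT.
- by rewrite bigcup_const.
- by move=> _ [A mA [B mB <-]]; exact: m12.
Qed.

Section density.
Context d (T : measurableType d) (R : realType) (mu : {measure set T -> \bar R}).
Variable f : T -> \bar R.
Hypotheses (mf : measurable_fun setT f) (f0 : forall x, (0 <= f x)%E).

Definition mdensity of measurable_fun setT f & (forall x, (0 <= f x)%E) :=
  fun A : set T => (\int[mu]_(x in A) f x)%E.

Let mdensity0 : mdensity mf f0 set0 = 0%E.
Proof. exact: integral_set0. Qed.

Let mdensity_ge0 A : (0 <= mdensity mf f0 A)%E.
Proof. exact: integral_ge0. Qed.

Let mdensity_sigma_additive : semi_sigma_additive (mdensity mf f0).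
Proof. exact: semi_sigma_additive_nng_induced. Qed.

HB.instance Definition _ := isMeasure.Build _ _ _ (mdensity mf f0)
  mdensity0 mdensity_ge0 mdensity_sigma_additive.
End density.

Section kernel_preimage.
Context d d' d'' (T : measurableType d) (U : measurableType d')
  (V : measurableType d'') (R : realType).
Variables (kappa : R.-pker U ~> V) (H : T -> U).
Hypothesis mH : measurable_fun setT H.

Definition kpreimage of measurable_fun setT H : T -> {measure set V -> \bar R} :=
  fun x => kappa (H x).

Let mkpreimage A : measurable A -> measurable_fun setT (kpreimage mH ^~ A).
Proof.
by move=> mA; exact: (measurableT_comp (measurable_kernel kappa A mA) mH).
Qed.

HB.instance Definition _ := isKernel.Build _ _ _ _ _ (kpreimage mH) mkpreimage.

Let kpreimage_prob x : kpreimage mH x setT = 1%E.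
Proof. exact: prob_kernel. Qed.

HB.instance Definition _ :=
  Kernel_isProbability.Build _ _ _ _ _ (kpreimage mH) kpreimage_prob.
End kernel_preimage.


(* [pushforward] with the measurability of the map as an argument, from which
   the measure structure is inferred; likewise [kpreimage] and [mdensity]. *)
Section image_measure.
Context d d' (T : measurableType d) (U : measurableType d') (R : realType).
Variables (m : {measure set T -> \bar R}) (f : T -> U).
Hypothesis mf : measurable_fun setT f.

Definition mimage of measurable_fun setT f := pushforward m f.

Let mimage0 : mimage mf set0 = 0%E.
Proof. by rewrite /mimage /pushforward preimage_set0 measure0. Qed.

Let mimage_ge0 A : (0 <= mimage mf A)%E.
Proof. exact: measure_ge0. Qed.

Let mimage_sigma_additive : semi_sigma_additive (mimage mf).
Proof.
move=> F mF tF mUF; rewrite /mimage /pushforward preimage_bigcup.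
apply: measure_semi_sigma_additive.
- by move=> n; exact: measurable_preimage.
- apply/trivIsetP => /= i j _ _ ij; rewrite -preimage_setI.
  by move/trivIsetP : tF => /(_ _ _ _ _ ij) ->//; rewrite preimage_set0.
- by rewrite -preimage_bigcup; exact: measurable_preimage.
Qed.

HB.instance Definition _ := isMeasure.Build _ _ _ (mimage mf)
  mimage0 mimage_ge0 mimage_sigma_additive.

End image_measure.

Section finite_image_measure.
Context d d' (T : measurableType d) (U : measurableType d') (R : realType).
Variables (m : {finite_measure set T -> \bar R}) (f : T -> U).
Hypothesis mf : measurable_fun setT f.

Let mimage_fin : fin_num_fun (mimage m mf).
Proof. by move=> A mA; apply: fin_num_measure; exact: measurable_preimage. Qed.

HB.instance Definition _ := Measure_isFinite.Build _ _ _ (mimage m mf) mimage_fin.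
End finite_image_measure.

(** * Disintegration of a joint law along a kernel *)

Section disintegration.
Local Open Scope ereal_scope.
Context d d1 d2 d3 d4 (T : measurableType d) (U : measurableType d1)
  (V : measurableType d2) (X : measurableType d3) (Y : measurableType d4)
  (R : realType).
Variables (P : probability T R) (H : T -> U) (kappa : R.-pker U ~> V).
Variables (I : T -> X) (J : T -> Y) (J' : V -> Y).
Hypotheses (mH : measurable_fun setT H) (mI : measurable_fun setT I).
Hypotheses (mJ : measurable_fun setT J) (mJ' : measurable_fun setT J').
(** In integrated form: over every event of [I], the kernel [kappa (H w)] averages to the law of
    [J], with [J'] as the copy of [J] on the target of the kernel. *)
Hypothesis rect : forall A B, measurable A -> measurable B ->
  P (I @^-1` A `&` J @^-1` B) = \int[P]_(w in I @^-1` A) kappa (H w) (J' @^-1` B).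

(* Both sides are integrals of [F] against measures on [X * Y], which agree on
   rectangles by [rect]. *)
Lemma ge0_integral_disintegration (F : X * Y -> \bar R) :
  measurable_fun setT F -> (forall z, 0 <= F z) ->
  \int[P]_w F (I w, J w) = \int[P]_w \int[kappa (H w)]_v F (I w, J' v).
Proof.
move=> mF F0.
pose f w := (I w, J w).
have mf : measurable_fun setT f by exact: measurable_fun_pair.
(* The [unit] factor comes from treating [P] as the constant kernel [l] with source [unit];
   composing it with [k] gives the law of [(I w, J' v)] when [w] follows [P] and [v] follows
   [kappa (H w)]. *)
pose g (p : (unit * T) * V) := (I p.1.2, J' p.2).
have mg : measurable_fun setT g.
  apply: measurable_fun_pair; last exact: measurableT_comp.
  by apply: measurableT_comp => //; apply: measurableT_comp.
have mH2 : measurable_fun setT (H \o @snd unit T) by exact: measurableT_comp.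
pose l := kprobability (measurable_cst (P : pprobability T R) : measurable_fun [set: unit] _).
pose k : R.-sfker (unit * T) ~> (X * Y)%type := kpreimage kappa mH2 \; @kdirac _ _ _ _ R _ mg.
have kE w G : measurable_fun setT G -> (forall z, 0 <= G z) ->
    \int[k (tt, w)]_z G z = \int[kappa (H w)]_v G (I w, J' v).
  move=> mG G0; rewrite integral_kcomp//.
  by apply: eq_integral => v _; rewrite integral_dirac// diracT mul1e.
transitivity (\int[mimage P mf]_z F z).
  by rewrite (ge0_integral_pushforward mf).
transitivity (\int[kcomp l k tt]_z F z).
  apply: eq_measure_integral => A mA _.
  apply: measure_prod_unique mA => [|{}A B mA mB].
    by rewrite /= /mimage /pushforward preimage_setT probability_setT ltry.
  rewrite /= /mimage /pushforward /= [X in P X](_ : _ = I @^-1` A `&` J @^-1` B)//.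
  rewrite rect// integral_mkcond; apply: eq_integral => w _.
  rewrite patchE /kcomp /kpreimage /=.
  have mJB : measurable (J' @^-1` B).
    exact: measurable_preimage.
  case: ifPn => [wA|wA].
    rewrite -[J' @^-1` B]setIT -integral_indic//; apply: eq_integral => v _.
    rewrite /kdirac /= diracE !indicE; congr (_%:E); congr (_%:R); congr nat_of_bool.
    by apply/idP/idP; rewrite !inE /=; [split=> //; exact: set_mem|case].
  apply/esym/integral0_eq => v _; rewrite /kdirac /= diracE.
  case: (boolP (_ \in _)) => //; rewrite inE => -[/= /mem_set].
  by rewrite -[_ \in _]/(w \in I @^-1` A) (negbTE wA).
rewrite integral_kcomp//; apply: eq_integral => w _.
exact: kE.
Qed.
End disintegration.

(** * Integrability, and almost sure comparison from integrals *)

Lemma ge0_integrableP d (T : measurableType d) (R : realType)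
    (mu : {measure set T -> \bar R}) (f : T -> R) :
  measurable_fun setT f -> (forall w, 0 <= f w) ->
  mu.-integrable setT (EFin \o f) <-> (\int[mu]_w (f w)%:E < +oo)%E.
Proof.
move=> mf f0.
have fE : (\int[mu]_w `|(EFin \o f) w| = \int[mu]_w (f w)%:E)%E.
  by apply: eq_integral => w _; rewrite /= ger0_norm.
split=> [/integrableP[_]|foo]; first by rewrite fE.
by apply/integrableP; split; [exact/measurable_EFinP|rewrite fE].
Qed.

(** On the set where [g < f] the difference is positive while its integral is at most zero, so the
    set is null. Testing one explicit set lets this be applied when integrals are compared only on a
    sub-sigma-algebra containing that set. *)
Lemma ae_le_integral_lt_set d (T : measurableType d) (R : realType)
    (mu : {measure set T -> \bar R}) (f g : T -> R) :
  mu.-integrable setT (EFin \o f) -> mu.-integrable setT (EFin \o g) ->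
  (\int[mu]_(w in [set w | (g w < f w)%R]) (f w)%:E <=
   \int[mu]_(w in [set w | (g w < f w)%R]) (g w)%:E)%E ->
  {ae mu, forall w, f w <= g w}.
Proof.
move=> fi gi; set D := [set w | g w < f w] => fg.
have mf : measurable_fun setT f by exact/measurable_EFinP/(measurable_int mu).
have mg : measurable_fun setT g by exact/measurable_EFinP/(measurable_int mu).
have mD : measurable D.
  rewrite -[D]setTI; have := measurable_fun_ltr mg mf.
  by move=> /(_ measurableT [set true]) /=; apply.
have [fiD giD] : mu.-integrable D (EFin \o f) /\ mu.-integrable D (EFin \o g).
  by split; [exact: integrableS fi|exact: integrableS gi].
have h0 w : D w -> (0 <= (f w - g w)%:E)%E.
  by rewrite /D /= lee_fin subr_ge0 => /ltW.
have int0 : (\int[mu]_(w in D) `|(f w - g w)%:E| = 0)%E.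
  under eq_integral => w /set_mem wD do rewrite (gee0_abs (h0 _ wD)).
  apply/eqP; rewrite eq_le integral_ge0// andbT.
  under eq_integral do rewrite EFinB.
  rewrite integralB_EFin// leeBlDr ?add0e//.
  exact: integrable_fin_num.
have mfgD : measurable_fun D (fun w => (f w - g w)%:E).
  by apply/measurable_EFinP/measurable_funTS; exact: measurable_funB.
have /ae_eq_integral_abs := int0; move=> /(_ mD mfgD).
apply: filterS => w h; rewrite leNgt; apply/negP => wD.
by have [] := h wD => /eqP; rewrite subr_eq0 gt_eqF.
Qed.

Lemma integral_mrestr d (T : measurableType d) (R : realType)
    (mu : {measure set T -> \bar R}) (E D : set T) (mE : measurable E)
    (f : T -> \bar R) :
  measurable D -> measurable_fun D f -> (forall x, D x -> (0 <= f x)%E) ->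
  (\int[mrestr mu mE]_(x in D) f x = \int[mu]_(x in E `&` D) f x)%E.
Proof.
move=> mD mf f0.
have nE : mrestr mu mE (~` E) = 0%E by rewrite /mrestr setICl measure0.
rewrite (ge0_negligible_integral _ mD mf f0 nE); last exact: measurableC.
rewrite setDE setCK setIC; apply: eq_measure_integral => A mA AED.
by rewrite /= /mrestr setIidl//; apply: subset_trans AED _; exact: subIsetl.
Qed.

(** * Conditional expectations and conditional probabilities *)

Section conditional_expectation.
Context d d' (T : measurableType d) (U : measurableType d') (R : realType).
Variables (P : probability T R) (H : T -> U).
Hypothesis mH : measurable_fun setT H.

(** The event where [g'] is below [g] is a preimage under [H], so on it the integrals of [g] and
    [g'] may be exchanged for those of [X] and [X']. *)
Lemma is_cexp_le (X X' : T -> R) (g g' : U -> R) :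
  is_cexp P H X g -> is_cexp P H X' g' ->
  (forall B, measurable B ->
    (\int[P]_(w in H @^-1` B) (X w)%:E <= \int[P]_(w in H @^-1` B) (X' w)%:E)%E) ->
  {ae P, forall w, g (H w) <= g' (H w)}.
Proof.
move=> [mg gi gE] [mg' gi' gE'] XX'.
apply: ae_le_integral_lt_set => //.
have mB : measurable [set u | g' u < g u].
  rewrite -[X in measurable X]setTI; have := measurable_fun_ltr mg' mg.
  by move=> /(_ measurableT [set true]) /=; apply.
by have := XX' _ mB; rewrite -gE// -gE'.
Qed.

Lemma is_cexp_uniq (X : T -> R) (g g' : U -> R) :
  is_cexp P H X g -> is_cexp P H X g' -> {ae P, forall w, g (H w) = g' (H w)}.
Proof.
move=> Xg Xg'; have := is_cexp_le Xg Xg' (fun _ _ => lexx _).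
have := is_cexp_le Xg' Xg (fun _ _ => lexx _).
by apply: filterS2 => w ? ?; apply/eqP; rewrite eq_le; apply/andP.
Qed.

(** Once some version exists, the choice in [cexp] returns a genuine version and not the default
    [cst 0]; hence a version as premise here and below. *)
Lemma cexp_version (X : T -> R) (g : U -> R) : is_cexp P H X g ->
  exists2 g', is_cexp P H X g' & cexp P H X = g' \o H.
Proof.
move=> Xg; rewrite /cexp; eexists; last by [].
by case: xgetP => [? _ //|/(_ g)].
Qed.

Lemma cexp_is_cexp (X : T -> R) (g : U -> R) : is_cexp P H X g ->
  {ae P, forall w, cexp P H X w = g (H w)}.
Proof.
by move=> Xg; have [g' Xg' ->] := cexp_version Xg; exact: is_cexp_uniq Xg' Xg.
Qed.

Lemma cexp_le (X X' : T -> R) (g g' : U -> R) :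
  is_cexp P H X g -> is_cexp P H X' g' ->
  (forall B, measurable B ->
    (\int[P]_(w in H @^-1` B) (X w)%:E <= \int[P]_(w in H @^-1` B) (X' w)%:E)%E) ->
  {ae P, forall w, cexp P H X w <= cexp P H X' w}.
Proof.
move=> /cexp_version[h Xh ->] /cexp_version[h' Xh' ->]; exact: is_cexp_le.
Qed.

(** [g] is the Radon-Nikodym derivative of the law of [H] on the event [E] with respect to the law
    of [H]. The weight [f] builds in the rule for pulling out a factor that is a function of [H],
    needed for products of conditional probabilities. *)
Lemma conditional_probability_ex (E : set T) : measurable E ->
  exists g : U -> R, [/\ measurable_fun setT g, forall u, 0 <= g u &
    forall (f : U -> \bar R) B, measurable_fun setT f ->
      (forall u, 0 <= f u)%E -> measurable B ->
      (\int[P]_(w in H @^-1` B) (f (H w) * (g (H w))%:E) =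
       \int[P]_(w in E `&` H @^-1` B) f (H w))%E].
Proof.
move=> mE.
have PE : (P E < +oo)%E by rewrite (le_lt_trans (probability_le1 _ _))// ltry.
pose mu := mimage P mH; pose nu := mimage (mfrestr mE PE) mH.
have numu : nu `<< mu.
  apply/null_content_dominatesP => A mA muA0; apply/eqP.
  rewrite -measure_le0 -[leRHS]muA0; apply: le_measure; rewrite ?inE.
  - by apply: measurableI => //; exact: measurable_preimage.
  - exact: measurable_preimage.
  - exact: subIsetl.
pose h := Radon_Nikodym_SigmaFinite.f nu mu.
have h0 u : (0 <= h u)%E by exact: Radon_Nikodym_SigmaFinite.f_ge0.
have hfin u : h u \is a fin_num by exact: Radon_Nikodym_SigmaFinite.f_fin_num.
have mh : measurable_fun setT h.
  exact: measurable_int (Radon_Nikodym_SigmaFinite.f_integrable numu).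
exists (fine \o h); split => [|u|f B mf f0 mB].
- exact: measurableT_comp.
- by rewrite fine_ge0.
have := Radon_Nikodym_SigmaFinite.change_of_variables numu f0 mB (measurable_funTS mf).
rewrite (ge0_integral_pushforward mH)//=; last 2 first.
- by apply: measurable_funTS; exact: emeasurable_funM.
- by move=> u _; rewrite mule_ge0.
rewrite (ge0_integral_pushforward mH)//=; last exact: measurable_funTS.
rewrite -/nu -/mu -/h => fh.
under eq_integral do rewrite fineK//.
rewrite fh -integral_mrestr//.
- exact: measurable_preimage.
- exact: measurable_funTS (measurableT_comp mf mH).
Qed.

Lemma is_cexp_indic (E : set T) (g : U -> R) : measurable E ->
  measurable_fun setT g -> (forall u, 0 <= g u) ->
  (forall B, measurable B -> (\int[P]_(w in H @^-1` B) (g (H w))%:E =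
                              P (E `&` H @^-1` B))%E) ->
  is_cexp P H \1_E g.
Proof.
move=> mE mg g0 gE; split => // [|B mB].
  apply/ge0_integrableP => [|w|]; [exact: measurableT_comp|exact: g0|].
  have /= := gE _ measurableT; rewrite preimage_setT /= => ->.
  by rewrite setIT (le_lt_trans (probability_le1 _ _))// ltry.
by rewrite integral_indic//; [rewrite gE|exact: measurable_preimage].
Qed.

End conditional_expectation.

(** * Conditional independence in terms of conditional probabilities *)

Section conditional_independence.
Context d d1 d2 d3 (T : measurableType d) (U : measurableType d1)
  (V : measurableType d2) (W : measurableType d3) (R : realType).
Variables (P : probability T R) (Z : T -> U) (X : T -> V) (Y : T -> W).
Hypotheses (mZ : measurable_fun setT Z) (mX : measurable_fun setT X).
Hypotheses (mY : measurable_fun setT Y) (XYZ : cond_indep P Z X Y).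
Variable B : set W.
Hypothesis mB : measurable B.

(** The conditional probability, given [Z], that [Y] lies in [B] also serves given the pair
    [(X, Z)]. Both sides are measures in [D], so rectangles suffice, and on these conditional
    independence gives a product. *)
Lemma cond_indep_conditional_probability :
  exists g : U -> R, [/\ measurable_fun setT g, forall u, 0 <= g u &
    forall D, measurable D ->
      P ((fun w => (X w, Z w)) @^-1` D `&` Y @^-1` B) =
      (\int[P]_(w in (fun w => (X w, Z w)) @^-1` D) (g (Z w))%:E)%E].
Proof.
have mYB : measurable (Y @^-1` B) by exact: measurable_preimage.
have cond1 E (g : U -> R) :
    measurable E -> measurable_fun setT g -> (forall u, 0 <= g u) ->
    (forall (f : U -> \bar R) C, measurable_fun setT f ->
      (forall u, 0 <= f u)%E -> measurable C ->
      (\int[P]_(w in Z @^-1` C) (f (Z w) * (g (Z w))%:E) =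
       \int[P]_(w in E `&` Z @^-1` C) f (Z w))%E) ->
    forall C, measurable C ->
      (\int[P]_(w in Z @^-1` C) (g (Z w))%:E = P (E `&` Z @^-1` C))%E.
  move=> mE mg g0 gE C mC.
  have mEC : measurable (E `&` Z @^-1` C).
    by apply: measurableI => //; exact: measurable_preimage.
  have := gE (cst 1%E) C (measurable_cst _) (fun=> lee01) mC.
  rewrite integral_cst// mul1e => <-.
  by apply: eq_integral => w _; rewrite mul1e.
have [g [mg g0 gE]] := conditional_probability_ex P mZ mYB.
exists g; split => //.
have mXZ : measurable_fun setT (fun w => (X w, Z w)) by exact: measurable_fun_pair.
have mgZ : measurable_fun setT (fun w => (g (Z w))%:E).
  by apply/measurable_EFinP; exact: measurableT_comp.
have gZ0 w : (0 <= (g (Z w))%:E)%E by rewrite lee_fin.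
pose m1 := mimage (mrestr P mYB) mXZ.
pose m2 := mimage (mdensity P mgZ gZ0) mXZ.
suff m12 : forall D, measurable D -> m1 D = m2 D by [].
move=> D mD; apply: measure_prod_unique mD => [|A C mA mC].
  rewrite /= /mimage /pushforward /= /mrestr preimage_setT setTI.
  by rewrite (le_lt_trans (probability_le1 _ _))// ltry.
have mXA : measurable (X @^-1` A) by exact: measurable_preimage.
have [gX [mgX gX0 gXE]] := conditional_probability_ex P mZ mXA.
have mXY : measurable (X @^-1` A `&` Y @^-1` B) by exact: measurableI.
have [gXY [mgXY gXY0 gXYE]] := conditional_probability_ex P mZ mXY.
have gXYM : {ae P, forall w, gXY (Z w) = gX (Z w) * g (Z w)}.
  have := XYZ mA mB.
  have /cexp_is_cexp := is_cexp_indic mZ mXY mgXY gXY0 (cond1 _ _ mXY mgXY gXY0 gXYE).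
  have /cexp_is_cexp := is_cexp_indic mZ mXA mgX gX0 (cond1 _ _ mXA mgX gX0 gXE).
  have /cexp_is_cexp := is_cexp_indic mZ mYB mg g0 (cond1 _ _ mYB mg g0 gE).
  move=> h1 h2 h3 h4.
  apply: filterS2; [|exact: filterI h1 h2|exact: filterI h3 h4].
  by move=> w [<- <-] [<-].
have mZC : measurable (Z @^-1` C) by exact: measurable_preimage.
(* On a rectangle the probability is the integral of [gXY], that is of [gX * g], over an event of
   [Z]; pulling out [g] turns the factor [gX] back into the event on [X]. *)
transitivity (P ((X @^-1` A `&` Y @^-1` B) `&` Z @^-1` C)).
  by rewrite /= /mimage /pushforward /mrestr /= setIAC.
rewrite -(cond1 _ _ mXY mgXY gXY0 gXYE)//.
transitivity (\int[P]_(w in Z @^-1` C) ((g (Z w))%:E * (gX (Z w))%:E))%E.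
  apply: ge0_ae_eq_integral => //.
  - by apply: measurable_funTS; apply/measurable_EFinP; exact: measurableT_comp.
  - apply: measurable_funTS; apply: emeasurable_funM => //.
    by apply/measurable_EFinP; exact: measurableT_comp.
  - by move=> w _; rewrite lee_fin.
  - by move=> w _; rewrite mule_ge0// lee_fin.
  - by apply: filterS gXYM => w -> _; rewrite -EFinM mulrC.
rewrite (gXE (EFin \o g))//; exact/measurable_EFinP.
Qed.

End conditional_independence.

(** * Sigma-algebras and regular conditional distributions *)

(** Inclusion of the sigma-algebra generated by [f] in that generated by [g]. Phrasing it by events
    avoids exhibiting [f] as a measurable function of [g]. *)
Definition sigma_le d d1 d2 (T : measurableType d) (U : measurableType d1)
    (V : measurableType d2) (f : T -> U) (g : T -> V) :=
  forall A, measurable A -> exists2 B, measurable B & g @^-1` B = f @^-1` A.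

(** In this form the inclusion can be proved by composing measurable maps and by checking
    generators. *)
Lemma sigma_leP d d1 d2 (T : measurableType d) (U : measurableType d1)
    (V : measurableType d2) (f : T -> U) (g : T -> V) :
  sigma_le f g <->
  measurable_fun [set: g_sigma_algebra_preimageType g] (f : g_sigma_algebra_preimageType g -> U).
Proof.
split=> [fg _ A mA|mf A mA].
  by have [B mB BA] := fg _ mA; exists B => //; rewrite BA.
by have [B mB BA] := mf measurableT _ mA; exists B => //; rewrite setTI in BA; rewrite BA setTI.
Qed.

Lemma sigma_le_refl d d1 (T : measurableType d) (U : measurableType d1)
    (f : T -> U) : sigma_le f f.
Proof. by move=> A mA; exists A. Qed.

Lemma sigma_le_trans d d1 d2 d3 (T : measurableType d) (U : measurableType d1)
    (V : measurableType d2) (W : measurableType d3)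
    (f : T -> U) (g : T -> V) (h : T -> W) :
  sigma_le f g -> sigma_le g h -> sigma_le f h.
Proof.
by move=> fg gh A /fg[B /gh[C mC CB] BA]; exists C => //; rewrite CB.
Qed.

Lemma sigma_le_comp d d1 d2 (T : measurableType d) (U : measurableType d1)
    (V : measurableType d2) (f : T -> U) (g : U -> V) :
  measurable_fun setT g -> sigma_le (g \o f) f.
Proof. by move=> mg A mA; exists (g @^-1` A) => //; exact: measurable_preimage. Qed.

Section regular_conditional_distribution.
Local Open Scope ereal_scope.
Context d d1 (T : measurableType d) (U : measurableType d1) (R : realType).
Variables (P : probability T R) (H : T -> U) (kappa : R.-pker U ~> T).
Hypotheses (mH : measurable_fun setT H) (rcd : is_rcd P H kappa).

(** A random element known from [H] may be frozen inside the kernel: this is the disintegration with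
    the identity for [J] and [J'], whose condition on rectangles is [is_rcd] since events of [X] are
    events of [H]. *)
Lemma ge0_integral_rcd d2 (V : measurableType d2) (X : T -> V)
    (F : V * T -> \bar R) :
  measurable_fun setT X -> sigma_le X H ->
  measurable_fun setT F -> (forall z, 0 <= F z) ->
  \int[P]_w F (X w, w) = \int[P]_w \int[kappa (H w)]_v F (X w, v).
Proof.
move=> mX XH mF F0.
apply: (@ge0_integral_disintegration _ _ _ _ _ T U T V T R P H kappa X id id) => //.
move=> A B mA mB; have [C mC CA] := XH _ mA.
by rewrite -CA rcd// setIC.
Qed.

Lemma measurable_fun_rcd_integral (f : T -> \bar R) :
  measurable_fun setT f -> (forall w, 0 <= f w) ->
  measurable_fun setT (fun w => \int[kappa (H w)]_v f v).
Proof.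
move=> mf f0.
have mk : measurable_fun setT (fun u => \int[kappa u]_v f v).
  by apply: measurable_fun_integral_kernel => // A mA; exact: measurable_kernel.
exact: measurableT_comp mk mH.
Qed.

Lemma ge0_integral_rcd_preimage (f : T -> \bar R) B :
  measurable_fun setT f -> (forall w, 0 <= f w) -> measurable B ->
  \int[P]_(w in H @^-1` B) f w =
  \int[P]_(w in H @^-1` B) \int[kappa (H w)]_v f v.
Proof.
move=> mf f0 mB.
pose F (z : U * T) := (\1_B z.1)%:E * f z.2.
have mF : measurable_fun setT F.
  apply: emeasurable_funM; last exact: measurableT_comp.
  by apply/measurable_EFinP; exact: measurableT_comp.
have F0 z : 0 <= F z by rewrite mule_ge0// lee_fin.
have := ge0_integral_rcd mH (@sigma_le_refl _ _ _ _ H) mF F0 => FE.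
rewrite integral_mkcond [in RHS]integral_mkcond.
transitivity (\int[P]_w F (H w, w)).
  apply: eq_integral => w _; rewrite patchE /F /= indicE.
  rewrite -[w \in H @^-1` B]/(H w \in B).
  by case: (H w \in B); rewrite ?mul1e ?mul0e.
rewrite FE; apply: eq_integral => w _; rewrite patchE /F /= indicE.
rewrite -[w \in H @^-1` B]/(H w \in B).
case: (H w \in B); first by apply: eq_integral => v _; rewrite mul1e.
by apply: integral0_eq => v _; rewrite mul0e.
Qed.

(** The kernel integral has the same total integral as [X], hence is integrable and almost surely
    finite. *)
Lemma rcd_integral_fin_num (X : T -> R) :
  P.-integrable setT (EFin \o X) -> (forall w, (0 <= X w)%R) ->
  {ae P, forall w, \int[kappa (H w)]_v (X v)%:E \is a fin_num}.
Proof.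
move=> Xi X0.
have mX : measurable_fun setT (EFin \o X) by exact: measurable_int Xi.
have EX0 w : 0 <= (EFin \o X) w by rewrite lee_fin.
have ge0 w : 0 <= \int[kappa (H w)]_v (X v)%:E.
  by apply: integral_ge0 => v _; rewrite lee_fin.
have iX : P.-integrable setT (fun w => \int[kappa (H w)]_v (X v)%:E).
  apply/integrableP; split; first exact: measurable_fun_rcd_integral.
  rewrite (eq_integral (fun w => \int[kappa (H w)]_v (X v)%:E)) => [|w _].
    rewrite -[X in \int[P]_(_ in X) _](preimage_setT H).
    rewrite -(@ge0_integral_rcd_preimage (EFin \o X))// preimage_setT.
    by apply/ge0_integrableP => //; exact/measurable_EFinP.
  by rewrite gee0_abs.
have := integrable_ae measurableT iX.
by apply: filterS => w; exact.
Qed.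

(** By almost sure finiteness, [fine] alters the kernel integral on a null set only. *)
Lemma is_cexp_rcd (X : T -> R) :
  P.-integrable setT (EFin \o X) -> (forall w, (0 <= X w)%R) ->
  is_cexp P H X (fun u => fine (\int[kappa u]_v (X v)%:E)).
Proof.
move=> Xi X0.
have mX : measurable_fun setT (EFin \o X) by exact: measurable_int Xi.
have EX0 w : 0 <= (EFin \o X) w by rewrite lee_fin.
have mk : measurable_fun setT (fun u => \int[kappa u]_v (X v)%:E).
  by apply: measurable_fun_integral_kernel => // A mA; exact: measurable_kernel.
have mg : measurable_fun setT (fun u => fine (\int[kappa u]_v (X v)%:E)).
  exact: measurableT_comp.
have gE B : measurable B ->
    \int[P]_(w in H @^-1` B) (fine (\int[kappa (H w)]_v (X v)%:E))%:E =
    \int[P]_(w in H @^-1` B) (X w)%:E.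
  move=> mB; rewrite (@ge0_integral_rcd_preimage (EFin \o X))//.
  have mHB : measurable (H @^-1` B) by exact: measurable_preimage.
  apply: ge0_ae_eq_integral => //.
  - apply: measurable_funTS; apply/measurable_EFinP.
    exact: measurableT_comp mg mH.
  - apply: measurable_funTS; exact: measurable_fun_rcd_integral.
  - by move=> w _; rewrite lee_fin fine_ge0// integral_ge0// => v _; exact: EX0.
  - by move=> w _; apply: integral_ge0 => v _; exact: EX0.
  - apply: filterS (rcd_integral_fin_num Xi X0) => w Xfin _.
    by rewrite fineK.
split => //.
apply/ge0_integrableP => [|w|]; first exact: measurableT_comp mg mH.
  by rewrite /= fine_ge0// integral_ge0// => v _; exact: EX0.
have := gE _ measurableT; rewrite preimage_setT => ->.
by apply/ge0_integrableP => //; exact/measurable_EFinP.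
Qed.

Section conditional_independence.
Context d2 d3 d4 (V : measurableType d2) (W : measurableType d3)
  (Z' : measurableType d4).
Variables (Z : T -> Z') (X : T -> V) (Y : T -> W).
Hypotheses (mZ : measurable_fun setT Z) (mX : measurable_fun setT X).
Hypotheses (mY : measurable_fun setT Y) (XYZ : cond_indep P Z X Y).
Hypotheses (ZH : sigma_le Z H) (HXZ : sigma_le H (fun w => (X w, Z w))).

(** Two conditional probabilities that [Y] lies in [B] agree almost surely: that of [kappa] given
    [H], and a function [g] of [Z] that serves given [(X, Z)]. Indeed [ZH] makes both measurable for
    the sigma-algebra of [H], and [HXZ] makes each event of [H] an event of [(X, Z)], so their
    integrals over it coincide. *)
Lemma cond_indep_rcd D B : measurable D -> measurable B ->
  P ((fun w => (X w, Z w)) @^-1` D `&` Y @^-1` B) =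
  \int[P]_(w in (fun w => (X w, Z w)) @^-1` D) kappa (H w) (Y @^-1` B).
Proof.
move=> mD mB.
have mYB : measurable (Y @^-1` B) by exact: measurable_preimage.
have mXZ : measurable_fun setT (fun w => (X w, Z w)) by exact: measurable_fun_pair.
have [g [mg g0 gE]] := cond_indep_conditional_probability mZ mX mY XYZ mB.
have k1 u : kappa u (Y @^-1` B) <= 1.
  by rewrite -(@prob_kernel _ _ _ _ _ kappa u) le_measure ?inE.
have kfin u : kappa u (Y @^-1` B) \is a fin_num.
  by rewrite ge0_fin_numE// (le_lt_trans (k1 u))// ltry.
pose f w := fine (kappa (H w) (Y @^-1` B)).
have mk : measurable_fun setT (fun u => fine (kappa u (Y @^-1` B))).
  by apply: measurableT_comp => //; exact: measurable_kernel.
have mf : measurable_fun setT f by exact: measurableT_comp mk mH.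
have mgZ : measurable_fun setT (g \o Z) by exact: measurableT_comp.
have f0 w : (0 <= f w)%R by rewrite fine_ge0.
have fgH C : measurable C ->
    \int[P]_(w in H @^-1` C) (f w)%:E = \int[P]_(w in H @^-1` C) (g (Z w))%:E.
  move=> mC; under eq_integral do rewrite fineK//.
  rewrite rcd//; have [E mE EC] := HXZ mC.
  by rewrite -EC -gE// setIC.
have fgS (S : set (g_sigma_algebra_preimageType H)) : measurable S ->
    \int[P]_(w in S) (f w)%:E = \int[P]_(w in S) (g (Z w))%:E.
  by move=> [C mC <-]; rewrite setTI; exact: fgH.
have fi : P.-integrable setT (EFin \o f).
  apply/ge0_integrableP => //.
  apply: (@le_lt_trans _ _ (\int[P]_w (cst 1 w))); last first.
    by rewrite integral_cst// mul1e (le_lt_trans (probability_le1 P measurableT))// ltry.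
  apply: ge0_le_integral => //.
  - by move=> w _; rewrite lee_fin.
  - exact/measurable_EFinP.
  - by move=> w _; rewrite fineK.
have gi : P.-integrable setT (EFin \o (g \o Z)).
  apply/ge0_integrableP => [//|w|]; first exact: g0.
  by rewrite -(fgS setT measurableT); apply/ge0_integrableP.
(* Measurability with respect to [H] places the sets where one function is below the other among the
   events to which [fgS] applies. *)
have mf' : measurable_fun [set: g_sigma_algebra_preimageType H] f.
  by apply/(@sigma_leP _ _ _ T _ _ f H); exact: (@sigma_le_comp _ _ _ _ _ _ H _ mk).
have mg' : measurable_fun [set: g_sigma_algebra_preimageType H] (g \o Z).
  apply/(@sigma_leP _ _ _ T _ _ (g \o Z) H).
  exact: (@sigma_le_trans _ _ _ _ T _ _ _ _ Z H (sigma_le_comp _ mg) ZH).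
have fg : {ae P, forall w, f w = g (Z w)}.
  have mlt1 := measurable_fun_ltr mg' mf' measurableT (Y := [set true]) I.
  have mlt2 := measurable_fun_ltr mf' mg' measurableT (Y := [set true]) I.
  rewrite !setTI in mlt1 mlt2.
  have := ae_le_integral_lt_set fi gi (eq_ind_r (fun x => x <= _) (lexx _) (fgS _ mlt1)).
  have := ae_le_integral_lt_set gi fi (eq_ind_r (fun x => _ <= x) (lexx _) (fgS _ mlt2)).
  by apply: filterS2 => w ? ?; apply/eqP; rewrite eq_le; apply/andP.
rewrite gE//; apply: ge0_ae_eq_integral => //.
- exact: measurable_preimage.
- by apply: measurable_funTS; exact/measurable_EFinP.
- by apply: measurable_funTS; exact: (measurableT_comp (measurable_kernel kappa _ mYB) mH).
- by move=> w _; rewrite lee_fin.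
- by apply: filterS fg => w <- _; rewrite /f fineK.
Qed.

(** The pair [(X, Z)] can be frozen although it may carry more information than [H]: conditional
    independence makes [kappa (H w)] the right law for [Y] all the same. *)
Lemma ge0_integral_cond_indep_rcd (F : (V * Z') * W -> \bar R) :
  measurable_fun setT F -> (forall z, 0 <= F z) ->
  \int[P]_w F ((X w, Z w), Y w) =
  \int[P]_w \int[kappa (H w)]_v F ((X w, Z w), Y v).
Proof.
move=> mF F0.
apply: (@ge0_integral_disintegration _ _ _ _ _ T U T (V * Z')%type W R P H kappa
  (fun w => (X w, Z w)) Y Y) => //; first exact: measurable_fun_pair.
exact: cond_indep_rcd.
Qed.

End conditional_independence.
End regular_conditional_distribution.

(** * The closed loop *)

Section histories.
Context d (T : measurableType d) (R : realType).

Lemma measurable_coord k : measurable_fun [set: hist R] (fun h : hist R => h k).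
Proof.
move=> _ B mB; rewrite setTI; apply: sub_sigma_algebra.
by exists k, B.
Qed.

Lemma measurable_hist (f : T -> hist R) :
  (forall k, measurable_fun setT (fun w => f w k)) -> measurable_fun setT f.
Proof.
move=> mf; apply: (@measurability _ _ T (hist R) setT f (@hist_cylinders R)) => //.
move=> _ [_ [k [B [mB ->]]] <-].
by rewrite setTI; have := mf k measurableT B mB; rewrite setTI.
Qed.

Lemma measurable_history (x : process) s :
  (forall t, t <= s -> measurable_fun setT (x t)) ->
  measurable_fun setT (history x s : T -> hist R).
Proof. by move=> mx; apply: measurable_hist => k; apply: mx; lia. Qed.

Lemma measurable_future (x : process) s :
  (forall t, measurable_fun setT (x t)) ->
  measurable_fun setT (future x s : T -> hist R).
Proof. by move=> mx; apply: measurable_hist => k; exact: mx. Qed.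

End histories.

Section closed_loop.
Context d (T : measurableType d) (R : realType).
Variables (eps : R -> R -> R) (gam past : @process _ T R) (dl : nat).
Variable fb : @feedback _ T R.
Local Notation run := (run eps gam past dl fb).
Local Notation rate := (rate eps gam past dl fb).

Lemma run_lt0 pol n t : t < 0 -> run pol n t = past t.
Proof.
move=> t0; elim: n => //= n <-; apply/funext => w.
by case: eqP => // tn; lia.
Qed.

Lemma run_rate pol n (k : nat) : (k < n)%N -> run pol n k%:Z = rate pol k%:Z.
Proof.
elim: n => // n IH; rewrite ltnS leq_eqVlt => /orP[/eqP ->|kn].
  by apply/funext => w; rewrite /Defs.rate absz_nat.
rewrite -IH//; apply/funext => w /=.
by case: eqP => // kn'; lia.
Qed.

Lemma rate_lt0 pol t : t < 0 -> rate pol t = past t.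
Proof. by move=> t0; apply/funext => w; rewrite /Defs.rate run_lt0. Qed.

Lemma info_eq (x y : @process _ T R) s w :
  (forall t, t <= s -> x t w = y t w) ->
  info eps gam fb x s w = info eps gam fb y s w.
Proof.
move=> xy; rewrite /info; congr pair; apply/funext => k; rewrite /history.
  by rewrite xy//; lia.
by rewrite xy//; lia.
Qed.

Hypothesis dl_gt0 : (0 < dl)%N.

(** The fixed-point equation of the closed loop: as the delay is positive, the information used at
    time [k] involves only rates before [k], which [run] has already settled. *)
Lemma rate_nat pol (k : nat) w :
  rate pol k%:Z w = pol k (info eps gam fb (rate pol) (k%:Z - dl%:Z) w).
Proof.
rewrite {1}/Defs.rate absz_nat /= eqxx; congr (pol k _).
apply: info_eq => t tk; have [t0|t0] := ltP t 0.
  by rewrite run_lt0// rate_lt0.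
by case: t t0 tk => // m _ tk; rewrite run_rate//; lia.
Qed.

Variables (Rset : set R) (N : nat).
Hypothesis past_adm : forall t w, t < 0 -> Rset (past t w).

Lemma rate_adm pol t w : admissible Rset N pol -> t <= N%:Z -> Rset (rate pol t w).
Proof.
move=> pol_adm; have [t0 _|] := ltP t 0.
  by rewrite rate_lt0//; exact: past_adm.
case: t => // k _ kN; rewrite rate_nat.
by have [|_] := pol_adm k; [lia|exact].
Qed.

Hypothesis eps_meas : measurable_fun setT (fun p : R * R => eps p.1 p.2).
Hypothesis fb_meas : forall t,
  measurable_fun setT (fun p : R * T => fb t p.1 p.2).
Hypothesis gam_meas : forall t, measurable_fun setT (gam t).
Hypothesis past_meas : forall t, t < 0 -> measurable_fun setT (past t).

Lemma measurable_info (r : @process _ T R) s :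
  (forall t, t <= s -> measurable_fun setT (r t)) ->
  measurable_fun setT (info eps gam fb r s).
Proof.
move=> mr; apply: measurable_fun_pair; apply: measurable_history => // t ts.
have me : measurable_fun setT (fun w => eps (r t w) (gam t w)).
  have mp : measurable_fun setT (fun w => (r t w, gam t w)).
    by apply: measurable_fun_pair => //; exact: mr.
  exact: measurableT_comp eps_meas mp.
have mp : measurable_fun setT (fun w => (eps (r t w) (gam t w), w)).
  exact: measurable_fun_pair.
exact: measurableT_comp (fb_meas t) mp.
Qed.

Lemma measurable_rate pol t : admissible Rset N pol -> t <= N%:Z ->
  measurable_fun setT (rate pol t).
Proof.
move=> pol_adm; have [t0 _|] := ltP t 0.
  by rewrite rate_lt0//; exact: past_meas.
(* Strong induction on time: the rate at [k] depends on rates up to [k - dl], which are past rates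
   or covered by the induction hypothesis. *)
case: t => // k _; elim/ltn_ind: k => k IH kN.
have [|mpol _] := pol_adm k; first by lia.
rewrite (_ : rate pol k%:Z =
    pol k \o info eps gam fb (rate pol) (k%:Z - dl%:Z)); last first.
  by apply/funext => w; rewrite rate_nat.
apply: measurableT_comp => //; apply: measurable_info => t tk.
have [t0|] := ltP t 0; first by rewrite rate_lt0//; exact: past_meas.
by case: t tk => // m mk _; apply: IH; lia.
Qed.

End closed_loop.

Lemma measurable_fun_kernel_integral d d1 d2 (T : measurableType d)
    (U : measurableType d1) (V : measurableType d2) (R : realType)
    (kappa : R.-pker U ~> V) (H : T -> U) (F : T * V -> \bar R) :
  measurable_fun setT H -> measurable_fun setT F -> (forall z, (0 <= F z)%E) ->
  measurable_fun setT (fun w => \int[kappa (H w)]_v F (w, v))%E.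
Proof.
move=> mH mF F0.
exact: (measurable_fun_integral_finite_kernel F (kpreimage kappa mH)).
Qed.

(** Freezing is applied to the indicator of [X w != X v]: it vanishes when [v] is [w] itself, so its
    kernel integral is zero almost surely. *)
Lemma rcd_ae_const d d1 (T : measurableType d) (U : measurableType d1)
    (R : realType) (P : probability T R) (H : T -> U) (kappa : R.-pker U ~> T)
    (X : T -> R) :
  measurable_fun setT H -> is_rcd P H kappa ->
  measurable_fun setT X -> sigma_le X H ->
  {ae P, forall w, {ae kappa (H w), forall v, X v = X w}}.
Proof.
move=> mH rcd mX XH.
pose N := [set p : R * T | p.1 != X p.2].
have mN : measurable N.
  rewrite (_ : N = (fun p : R * T => p.1 == (X \o snd) p) @^-1` [set false]).
    apply: measurable_preimage => //; apply: measurable_fun_eqr => //.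
    exact: measurableT_comp.
  by apply/seteqP; split => p /=; rewrite /N /=; case: eqP.
have mF : measurable_fun setT (fun z => (\1_N z)%:E : \bar R).
  exact/measurable_EFinP.
have F0 (z : R * T) : (0 <= (\1_N z)%:E :> \bar R)%E by rewrite lee_fin.
have := ge0_integral_rcd mH rcd mX XH mF F0.
rewrite integral0_eq => [/esym intN0|w _]; last first.
  by rewrite indicE memNset// /N /= eqxx.
have mXw : measurable_fun setT (fun z : T * T => (\1_N (X z.1, z.2))%:E : \bar R).
  have mp : measurable_fun setT (fun z : T * T => (X z.1, z.2)).
    by apply: measurable_fun_pair => //; exact: measurableT_comp.
  exact: measurableT_comp mF mp.
have mI := measurable_fun_kernel_integral kappa mH mXw (fun=> F0 _).
have /ae_eq_integral_abs : (\int[P]_w `|\int[kappa (H w)]_v (\1_N (X w, v))%:E| = 0)%E.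
  rewrite -[RHS]intN0; apply: eq_integral => w _.
  by rewrite gee0_abs// integral_ge0.
move=> /(_ measurableT mI); apply: filterS => w /(_ Logic.I) /= h.
have mNw : measurable [set v : T | X w != X v].
  have mp : measurable_fun setT (fun v : T => (X w, v)).
    exact: (measurable_fun_pair (measurable_cst _) (@measurable_id _ _ _)).
  exact: measurable_preimage mp mN.
exists [set v : T | X w != X v]; split => //.
- have := integral_indic (kappa (H w)) measurableT mNw.
  by rewrite setIT => <-; exact: h.
- by move=> v /= /eqP; rewrite eq_sym.
Qed.

Lemma integrable_sum_nat d (T : measurableType d) (R : realType)
    (mu : {measure set T -> \bar R}) (F : nat -> T -> R) m n :
  (forall k, (m <= k < n)%N -> mu.-integrable setT (EFin \o F k)) ->
  mu.-integrable setT (EFin \o (fun w => \sum_(m <= k < n) F k w)).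
Proof.
move=> Fi.
rewrite (_ : EFin \o _ =
    fun w => (\sum_(m <= k < n | (m <= k < n)%N && true) (F k w)%:E)%E).
  by apply: integrable_sum => // k /andP[/Fi].
by apply/funext => w /=; rewrite -sumEFin [LHS]big_nat_cond.
Qed.

Lemma le_integral_sum d (T : measurableType d) (R : realType)
    (mu : {measure set T -> \bar R}) (D : set T) (I : Type) (s : seq I)
    (F G : I -> T -> R) :
  measurable D ->
  (forall k, measurable_fun setT (F k)) -> (forall k, measurable_fun setT (G k)) ->
  (forall k w, 0 <= F k w) -> (forall k w, 0 <= G k w) ->
  (forall k,
    (\int[mu]_(w in D) (F k w)%:E <= \int[mu]_(w in D) (G k w)%:E)%E) ->
  (\int[mu]_(w in D) (\sum_(k <- s) F k w)%:E <=
   \int[mu]_(w in D) (\sum_(k <- s) G k w)%:E)%E.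
Proof.
move=> mD mF mG F0 G0 FG.
under eq_integral do rewrite -sumEFin.
under [leRHS]eq_integral do rewrite -sumEFin.
rewrite !ge0_integral_sum//; first exact: lee_sum.
- by move=> k; apply: measurable_funTS; exact/measurable_EFinP.
- by move=> k w _; rewrite lee_fin.
- by move=> k; apply: measurable_funTS; exact/measurable_EFinP.
- by move=> k w _; rewrite lee_fin.
Qed.

(** * The causal genie *)

Lemma goodput_ge0 (R : realType) (Rset : set R) (eps : R -> R -> R) r x :
  (forall r, Rset r -> 0 <= r) ->
  (forall r x, Rset r -> 0 <= x -> 0 <= eps r x <= 1) ->
  Rset r -> 0 <= x -> 0 <= goodput eps r x.
Proof.
move=> Rset0 eps01 rR x0; have /andP[_ e1] := eps01 _ _ rR x0.
by rewrite /goodput mulr_ge0 ?subr_ge0 ?Rset0.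
Qed.

Lemma measurable_goodput d (T : measurableType d) (R : realType)
    (eps : R -> R -> R) (r x : T -> R) :
  measurable_fun setT (fun p : R * R => eps p.1 p.2) ->
  measurable_fun setT r -> measurable_fun setT x ->
  measurable_fun setT (fun w => goodput eps (r w) (x w)).
Proof.
move=> meps mr mx; apply: measurable_funM => //; apply: measurable_funB => //.
have mp : measurable_fun setT (fun w => (r w, x w)) by exact: measurable_fun_pair.
exact: measurableT_comp meps mp.
Qed.

(** Strict monotonicity inverts the error rate: for [0 <= q] the SNR exceeds [q] exactly when the
    observed error rate is below [eps r q], where [r] is observed too. Open rays generate the Borel
    sets. *)
Lemma sigma_le_history_info d (T : measurableType d) (R : realType)
    (Rset : set R) (eps : R -> R -> R) (gam r : @process _ T R) s :
  measurable_fun setT (fun p : R * R => eps p.1 p.2) ->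
  (forall r x y, Rset r -> 0 <= x -> x < y -> eps r y < eps r x) ->
  (forall t w, 0 <= gam t w) ->
  (forall t w, t <= s -> Rset (r t w)) ->
  sigma_le (history gam s : T -> hist R)
    (info eps gam (@perfect_feedback _ T R) r s).
Proof.
move=> meps eps_decr gam0 rR; set H := info _ _ _ _ _.
apply/sigma_leP; apply: measurable_hist => k.
have /sigma_leP mH := @sigma_le_refl _ _ _ _ H.
have mr : measurable_fun [set: g_sigma_algebra_preimageType H] (fun w => (H w).2 k).
  exact: measurableT_comp (measurable_coord k) (measurableT_comp measurable_snd mH).
have me : measurable_fun [set: g_sigma_algebra_preimageType H] (fun w => (H w).1 k).
  exact: measurableT_comp (measurable_coord k) (measurableT_comp measurable_fst mH).
apply: (measurability _ (RGenOInfty.measurableE R)) => _ [_ [q ->] <-].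
(* [eps_decr] compares nonnegative SNRs; a negative [q] gives the full event. *)
rewrite setTI; have [q0|q0] := ltP q 0.
  rewrite (_ : _ @^-1` _ = setT); first exact: measurableT.
  by apply/seteqP; split => // w _ /=; rewrite in_itv/= andbT (lt_le_trans q0)// gam0.
have mrq : measurable_fun [set: g_sigma_algebra_preimageType H]
    (fun w => eps ((H w).2 k) q).
  have mp : measurable_fun [set: g_sigma_algebra_preimageType H]
      (fun w => ((H w).2 k, q)) by exact: measurable_fun_pair.
  exact: measurableT_comp meps mp.
have := measurable_fun_ltr me mrq measurableT (Y := [set true]) Logic.I.
rewrite setTI; congr measurable; apply/seteqP; split => w /=;
  rewrite in_itv/= andbT /history /perfect_feedback.
- rewrite ltNge => /negP h; rewrite ltNge; apply/negP => gq; apply: h.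
  have := gq; rewrite le_eqVlt => /orP[/eqP ->//|gq'].
  by apply/ltW/eps_decr => //; apply: rR; lia.
- by move=> qg; apply: eps_decr => //; apply: rR; lia.
Qed.

(** Histories are stored backwards from the present, so the older information is the newer one with
    its first [t - s] entries dropped. *)
Lemma sigma_le_info_shift d (T : measurableType d) (R : realType)
    (eps : R -> R -> R) (gam x y : @process _ T R) fb (s t : int) :
  s <= t -> (forall j w, j <= s -> x j w = y j w) ->
  sigma_le (info eps gam fb x s) (info eps gam fb y t).
Proof.
move=> st xy.
pose shift (h : hist R) : hist R := fun k => h (k + `|t - s|)%N.
have mshift : measurable_fun setT shift.
  by apply: measurable_hist => k; exact: measurable_coord.
have -> : info eps gam fb x s =
    (fun h => (shift h.1, shift h.2)) \o info eps gam fb y t.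
  have tE (k : nat) : t - (k + `|t - s|)%N%:Z = s - k%:Z by lia.
  apply/funext => w; rewrite /info /history /shift /=.
  congr pair; apply/funext => k; rewrite tE xy//; lia.
apply: sigma_le_comp; apply: measurable_fun_pair.
- exact: measurableT_comp mshift measurable_fst.
- exact: measurableT_comp mshift measurable_snd.
Qed.

Section causal_genie.
Context d (T : measurableType d) (R : realType).
Variables (P : probability T R) (dl N : nat) (Rset : set R).
Hypothesis dl_gt0 : (0 < dl)%N.
Hypothesis Rset_ge0 : forall r, Rset r -> 0 <= r.
Variable eps : R -> R -> R.
Hypothesis eps_meas : measurable_fun setT (fun p : R * R => eps p.1 p.2).
Hypothesis eps_range : forall r x, Rset r -> 0 <= x -> 0 <= eps r x <= 1.
Variables (gam past : @process _ T R).
Hypothesis gam_meas : forall t, measurable_fun setT (gam t).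
Hypothesis gam_ge0 : forall t w, 0 <= gam t w.
Hypothesis past_meas : forall t, t < 0 -> measurable_fun setT (past t).
Hypothesis past_adm : forall t w, t < 0 -> Rset (past t w).
Variable rcg : @policy R.
Hypothesis rcg_opt :
  optimal_allocation eps gam past dl (@perfect_feedback _ T R) P Rset N rcg.
Hypothesis rcg_snr : function_of_snr eps Rset N rcg.
Local Notation rate := (rate eps gam past dl (@perfect_feedback _ T R)).
Hypothesis rcg_fin : forall t : nat, (t <= N)%N ->
  P.-integrable setT (fun w => (goodput eps (rate rcg t%:Z w) (gam t%:Z w))%:E).

(* The genie's rate as a function of the SNR history: by [rcg_snr] the choice of
   the rate [r0] used to code the SNRs as error rates does not matter. *)
Definition snr_rate (r0 : R) (k : nat) (x : hist R) : R :=
  rcg k (fun j => eps r0 (x j), fun=> r0).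

Let rcg_adm : admissible Rset N rcg. Proof. by case: rcg_opt. Qed.

Lemma measurable_snr_rate r0 k : (k <= N)%N ->
  measurable_fun setT (snr_rate r0 k).
Proof.
move=> kN; have [mk _] := rcg_adm kN.
have mp : measurable_fun [set: hist R]
    (fun x : hist R => (fun j => eps r0 (x j), fun=> r0) : hist R * hist R).
  apply: measurable_fun_pair; apply: measurable_hist => j; last exact: measurable_cst.
  have mq : measurable_fun [set: hist R] (fun x : hist R => (r0, x j)).
    by apply: measurable_fun_pair; [exact: measurable_cst|exact: measurable_coord].
  exact: measurableT_comp eps_meas mq.
exact: measurableT_comp mk mp.
Qed.

Lemma measurable_perfect_feedback t :
  measurable_fun setT (fun p : R * T => perfect_feedback t p.1 p.2).
Proof. exact: measurable_fst. Qed.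

(** Agreement with [rcg] at time [k] alone suffices: the other decisions of [pol] change the error
    rates that encode the SNRs, not the SNRs themselves. This covers a policy deviating at an
    earlier time. *)
Lemma rate_snr_rate r0 pol (k : nat) w : Rset r0 -> admissible Rset N pol ->
  (k <= N)%N -> pol k = rcg k ->
  rate pol k%:Z w = snr_rate r0 k (history gam (k%:Z - dl%:Z) w).
Proof.
move=> r0R pol_adm kN polk; rewrite rate_nat// polk.
rewrite /snr_rate; apply: (rcg_snr (x := history gam (k%:Z - dl%:Z) w)) => // j.
  exact: gam_ge0.
by apply: (rate_adm _ _ _ dl_gt0 past_adm w pol_adm); lia.
Qed.

(** [X] supplies the rates at negative times; the genie's rates from time 0 on are functions of the
    SNR history, and error rates are functions of rates and SNRs. *)
Lemma sigma_le_genie_info d' (V : measurableType d') (X : T -> V) (s : int) :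
  s <= N%:Z ->
  (forall t, t < 0 -> t <= s ->
    measurable_fun [set: g_sigma_algebra_preimageType (fun w => (X w, history gam s w : hist R))]
      (past t : g_sigma_algebra_preimageType _ -> R)) ->
  sigma_le (info eps gam (@perfect_feedback _ T R) (rate rcg) s)
    (fun w => (X w, history gam s w : hist R)).
Proof.
move=> sN; set J := (fun w => (X w, history gam s w : hist R)) => mpast.
(* Admissibility of the past makes [Rset] nonempty; the time -1 and the outcome [point] are
   arbitrary choices. *)
have [r0 r0R] : exists r0, Rset r0.
  by exists (past (-1) point); exact: past_adm.
have /sigma_leP mJ := @sigma_le_refl _ _ _ _ J.
have mhist : measurable_fun [set: g_sigma_algebra_preimageType J]
    (fun w => history gam s w : hist R) by exact: measurableT_comp measurable_snd mJ.
have mgam t : t <= s -> measurable_fun [set: g_sigma_algebra_preimageType J]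
    (gam t : g_sigma_algebra_preimageType J -> R).
  move=> ts; rewrite (_ : gam t = fun w => history gam s w `|s - t|%N).
    exact: measurableT_comp (measurable_coord _) mhist.
  by apply/funext => w; rewrite /history; congr (gam _ _); lia.
have mrate t : t <= s -> measurable_fun [set: g_sigma_algebra_preimageType J]
    (rate rcg t : g_sigma_algebra_preimageType J -> R).
  move=> ts; have [t0|] := ltP t 0; first by rewrite rate_lt0//; exact: mpast.
  case: t ts => // k ks _.
  rewrite (_ : rate rcg k%:Z =
      fun w => snr_rate r0 k (history gam (k%:Z - dl%:Z) w)); last first.
    by apply/funext => w; apply: rate_snr_rate => //; lia.
  have kN : (k <= N)%N by lia.
  apply: (measurableT_comp (measurable_snr_rate r0 kN)).
  by apply: measurable_history => t tk; apply: mgam; lia.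
apply/sigma_leP; apply: measurable_fun_pair; apply: measurable_history => t ts.
  have mp : measurable_fun [set: g_sigma_algebra_preimageType J]
      (fun w => (rate rcg t w, gam t w)).
    by apply: measurable_fun_pair; [exact: mrate|exact: mgam].
  exact: measurableT_comp eps_meas mp.
exact: mrate.
Qed.

(* The rates after [t] depend on the SNRs alone, hence cancel in the recursion
   and the genie maximizes each expected goodput separately. *)
Lemma genie_goodput_max (t : nat) : (t <= N)%N ->
  exists kappa : R.-pker (hist R * hist R)%type ~> T,
    let H := info eps gam (@perfect_feedback _ T R) (rate rcg) (t%:Z - dl%:Z) in
    is_rcd P H kappa /\
    {ae P, forall w r, Rset r ->
      (\int[kappa (H w)]_v (goodput eps r (gam t%:Z v))%:E <=
       \int[kappa (H w)]_v (goodput eps (rate rcg t%:Z v) (gam t%:Z v))%:E)%E}.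
Proof.
move=> tN; have [r0 r0R] : exists r0, Rset r0.
  by exists (past (-1) point); exact: past_adm.
have [_ /(_ rcg rcg_adm t tN)] := rcg_opt.
(* The recursion is used along the genie's own path, with [rcg] also in the role of the earlier
   policy [rho]. *)
have -> : switch dl t rcg rcg = rcg by apply/funext => j; rewrite /switch if_same.
move=> [kappa [rcd opt]]; exists kappa; split => //.
set H := info _ _ _ _ _ in rcd opt *.
pose S v := \sum_(t.+1 <= k < N.+1) goodput eps (rate rcg k%:Z v) (gam k%:Z v).
have G0 (k : nat) v : (k <= N)%N -> 0 <= goodput eps (rate rcg k%:Z v) (gam k%:Z v).
  move=> kN; apply: (goodput_ge0 Rset_ge0 eps_range) => //.
  by apply: (rate_adm _ _ _ dl_gt0 past_adm v rcg_adm); lia.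
have S0 v : 0 <= S v.
  by rewrite /S big_nat_cond sumr_ge0// => k /andP[/andP[_ kN] _]; apply: G0.
have Si : P.-integrable setT (EFin \o S).
  by apply: integrable_sum_nat => k /andP[_ kN]; exact: rcg_fin.
have mS : measurable_fun setT S by exact/measurable_EFinP/(measurable_int P).
(* Deviating at time [t] changes the term at [t] only: the later rates remain the same functions of
   the SNRs, so the later terms still sum to [S]. *)
have total_deviate r v : Rset r ->
    total_goodput eps gam past dl (@perfect_feedback _ T R) N (deviate t r rcg) t v =
    goodput eps r (gam t%:Z v) + S v.
  move=> rR; rewrite /total_goodput big_ltn ?ltnS//; congr (_ + _).
    by rewrite rate_nat// /deviate eqxx.
  have dev_adm : admissible Rset N (deviate t r rcg).
    move=> k kN; rewrite /deviate; case: ifP => _; last exact: rcg_adm.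
    by split => //; exact: measurable_cst.
  apply: eq_big_nat => k /andP[tk kN]; congr (goodput _ _ _).
  rewrite (rate_snr_rate _ r0R dev_adm)//; last first.
    by rewrite /deviate gtn_eqF.
  by rewrite (rate_snr_rate _ r0R rcg_adm).
have mrate s : s <= N%:Z -> measurable_fun setT (rate rcg s).
  exact: (measurable_rate dl_gt0 eps_meas measurable_perfect_feedback
    gam_meas past_meas rcg_adm).
have mH : measurable_fun setT H.
  apply: (measurable_info eps_meas measurable_perfect_feedback gam_meas) => s st.
  by apply: mrate; lia.
(* Finiteness of the kernel integral of [S] is what permits cancelling it in the extended reals. *)
have := rcd_integral_fin_num mH rcd Si S0.
move: opt; apply: filterS2 => w opt Sfin r rR.
have := opt r rR.
have mG (q : T -> R) : measurable_fun setT q ->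
   measurable_fun setT (fun v => (goodput eps (q v) (gam t%:Z v))%:E).
  by move=> mq; apply/measurable_EFinP; exact: measurable_goodput.
have mES : measurable_fun setT (EFin \o S) by exact/measurable_EFinP.
under eq_integral do rewrite total_deviate// EFinD.
under [leRHS]eq_integral do rewrite /total_goodput big_ltn ?ltnS// EFinD.
rewrite !ge0_integralD//=.
- by rewrite leeD2rE.
- by move=> v _; rewrite lee_fin G0.
- exact/mG/mrate.
- by move=> v _; rewrite lee_fin S0.
- by move=> v _; rewrite lee_fin (goodput_ge0 Rset_ge0 eps_range).
- exact: mG (measurable_cst _).
- by move=> v _; rewrite lee_fin S0.
Qed.
End causal_genie.

(** * Comparison of the two systems *)

(** The comparison is in integrated form over the events of the competitor's information, so that it
    passes to any coarser sigma-algebra, such as that of the initial information. *)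
Lemma goodput_le_genie (R : realType) (disp : measure_display)
  (Omega : measurableType disp) (P : probability Omega R)
  (d N : nat) (hd : (0 < d)%N)
  (Rset : set R) (hRset : forall r, Rset r -> 0 <= r)
  (eps : R -> R -> R)
  (eps_meas : measurable_fun setT (fun p : R * R => eps p.1 p.2))
  (eps_range : forall r x, Rset r -> 0 <= x -> 0 <= eps r x <= 1)
  (eps_decr : forall r x y, Rset r -> 0 <= x -> x < y -> eps r y < eps r x)
  (gam : int -> Omega -> R)
  (gam_meas : forall t, measurable_fun setT (gam t))
  (gam_ge0 : forall t w, 0 <= gam t w)
  (past : int -> Omega -> R)
  (past_meas : forall t, t < 0 -> measurable_fun setT (past t))
  (past_adm : forall t w, t < 0 -> Rset (past t w))
  (fb : int -> R -> Omega -> R)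
  (fb_meas : forall t,
     measurable_fun setT (fun p : R * Omega => fb t p.1 p.2))
  (rstar rcg : policy)
  (rstar_adm : admissible Rset N rstar)
  (rcg_opt : optimal_allocation eps gam past d perfect_feedback P Rset N rcg)
  (rcg_snr : function_of_snr eps Rset N rcg)
  (rcg_fin : forall t : nat, (t <= N)%N ->
     P.-integrable setT (fun w =>
       (goodput eps (rate eps gam past d perfect_feedback rcg t%:Z w)
          (gam t%:Z w))%:E))
  (t : nat) (tN : (t <= N)%N) :
  let I := info eps gam fb (rate eps gam past d fb rstar) (t%:Z - d%:Z) in
  cond_indep P (history gam (t%:Z - d%:Z)) I (future gam (t%:Z - d%:Z)) ->
  forall B, measurable B ->
  (\int[P]_(w in I @^-1` B)
     (goodput eps (rate eps gam past d fb rstar t%:Z w) (gam t%:Z w))%:E <=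
   \int[P]_(w in I @^-1` B)
     (goodput eps (rate eps gam past d perfect_feedback rcg t%:Z w)
        (gam t%:Z w))%:E)%E.
Proof.
set r := rate _ _ _ _ fb _; set g := rate _ _ _ _ perfect_feedback _.
set s : int := t%:Z - d%:Z; move=> I IY B mB.
set Z : Omega -> hist R := history gam s in IY.
set Y : Omega -> hist R := future gam s in IY.
have sN : s <= N%:Z by rewrite /s; lia.
have rcg_adm : admissible Rset N rcg by case: rcg_opt.
have [kappa []] := genie_goodput_max hd hRset eps_meas eps_range gam_meas
  gam_ge0 past_meas past_adm rcg_opt rcg_snr rcg_fin tN.
rewrite -/g -/s; set H := info _ _ _ _ _ => rcd gmax.
have [r0 r0R] : exists r0, Rset r0 by exists (past (-1) point); exact: past_adm.
pose c := snr_rate eps rcg r0 t.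
have gE w : g t%:Z w = c (Z w).
  by rewrite /g (rate_snr_rate hd gam_ge0 past_adm rcg_snr w r0R rcg_adm).
have rE w : r t%:Z w = rstar t (I w) by exact: rate_nat.
(* Index 0 of the future after [s] is time [s + 1], so time [t = s + d] has index [d.-1]. *)
have YE w : Y w d.-1 = gam t%:Z w by rewrite /Y /future; congr (gam _ _); rewrite /s; lia.
have [mrstar rstarR] := rstar_adm t tN.
have mc : measurable_fun setT c by exact: (measurable_snr_rate eps_meas rcg_opt r0 tN).
have mr u : u <= N%:Z -> measurable_fun setT (r u).
  exact: (measurable_rate hd eps_meas fb_meas gam_meas past_meas rstar_adm).
have mg u : u <= N%:Z -> measurable_fun setT (g u).
  exact: (measurable_rate hd eps_meas (@measurable_perfect_feedback _ _ _)
    gam_meas past_meas rcg_adm).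
have mI : measurable_fun setT I.
  by apply: (measurable_info eps_meas fb_meas gam_meas) => u us; apply: mr; lia.
have mH : measurable_fun setT H.
  by apply: (measurable_info eps_meas (@measurable_perfect_feedback _ _ _) gam_meas) => u us; apply: mg; lia.
have mZ : measurable_fun setT Z by exact: measurable_history.
have mY : measurable_fun setT Y by exact: measurable_future.
have ZH : sigma_le Z H.
  apply: (sigma_le_history_info eps_meas eps_decr gam_ge0) => u w us.
  by apply: (rate_adm _ _ _ hd past_adm w rcg_adm); lia.
(* The past rates are coordinates of the rate history contained in [I]. *)
have HIZ : sigma_le H (fun w => (I w, Z w)).
  apply: (sigma_le_genie_info hd eps_meas gam_ge0 past_adm rcg_opt rcg_snr sN).
  move=> u u0 us; have /sigma_leP mIZ := @sigma_le_refl _ _ _ _ (fun w => (I w, Z w)).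
  have mI2 := measurableT_comp measurable_snd (measurableT_comp measurable_fst mIZ).
  have := measurableT_comp (measurable_coord `|s - u|%N) mI2.
  congr (measurable_fun _ _); apply/funext => w.
  rewrite /I /info /history /= /r; have -> : s - `|s - u|%N%:Z = u by lia.
  by rewrite rate_lt0.
(* The absolute value keeps [F] nonnegative at arbitrary points of the history spaces; on actual
   rates and SNRs the goodput is already nonnegative. *)
pose F (q : hist R * hist R -> hist R -> R) (z : (hist R * hist R) * hist R * hist R) :=
  ((\1_B z.1.1)%:E * (`|goodput eps (q z.1.1 z.1.2) (z.2 d.-1)|)%:E)%E.
have F0 q z : (0 <= F q z)%E by rewrite mule_ge0// lee_fin.
have mF q : measurable_fun setT (fun z : (hist R * hist R) * hist R => q z.1 z.2) ->
    measurable_fun setT (F q).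
  move=> mq; apply: emeasurable_funM.
    apply/measurable_EFinP; apply: measurableT_comp => //.
    exact: measurableT_comp measurable_fst measurable_fst.
  apply/measurable_EFinP; apply: measurableT_comp => //.
  apply: measurable_goodput => //.
    exact: measurableT_comp mq measurable_fst.
  exact: measurableT_comp (measurable_coord _) measurable_snd.
pose qr (i : hist R * hist R) (z : hist R) := rstar t i.
pose qg (i : hist R * hist R) (z : hist R) := c z.
have mqr : measurable_fun setT (F qr).
  by apply: mF; exact: measurableT_comp mrstar measurable_fst.
have mqg : measurable_fun setT (F qg).
  by apply: mF; exact: measurableT_comp mc measurable_snd.
have FE q (a : Omega -> R) :
    (forall w, a w = q (I w) (Z w)) -> (forall w, Rset (a w)) ->
    (\int[P]_(w in I @^-1` B) (goodput eps (a w) (gam t%:Z w))%:E =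
     \int[P]_w F q (I w, Z w, Y w))%E.
  move=> aq aR; rewrite integral_mkcond; apply: eq_integral => w _.
  rewrite patchE /F /= YE -aq indicE -[w \in _]/(I w \in B).
  rewrite ger0_norm ?(goodput_ge0 hRset eps_range)//.
  by case: (I w \in B); rewrite ?mul1e ?mul0e.
have rR w : Rset (r t%:Z w).
  by apply: (rate_adm _ _ _ hd past_adm w rstar_adm); lia.
have gR w : Rset (g t%:Z w).
  by apply: (rate_adm _ _ _ hd past_adm w rcg_adm); lia.
rewrite (FE qr)// (FE qg)//.
(* Both sides now integrate out the SNR at [t] under [kappa (H w)] with [I] and [Z] frozen, so the
   competing rate becomes a constant to which the genie's pointwise optimality applies. *)
rewrite !(ge0_integral_cond_indep_rcd mH rcd mZ mI mY IY ZH HIZ)//.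
have mint q : measurable_fun setT (F q) ->
    measurable_fun setT (fun w => \int[kappa (H w)]_v F q (I w, Z w, Y v))%E.
  move=> mFq.
  have mp : measurable_fun setT (fun z : Omega * Omega => (I z.1, Z z.1, Y z.2)).
    apply: measurable_fun_pair; last exact: measurableT_comp.
    by apply: measurable_fun_pair; exact: measurableT_comp.
  exact: (measurable_fun_kernel_integral kappa mH (measurableT_comp mFq mp) (fun=> F0 _ _)).
apply: ae_ge0_le_integral => //.
- by move=> w _; exact: integral_ge0.
- exact: mint.
- by move=> w _; exact: integral_ge0.
- exact: mint.
have gZ : g t%:Z = c \o Z by apply/funext => w; rewrite gE.
have gH : sigma_le (g t%:Z) H.
  by rewrite gZ; exact: (@sigma_le_trans _ _ _ _ Omega _ _ _ _ Z H (sigma_le_comp _ mc) ZH).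
have mgt : measurable_fun setT (g t%:Z) by apply: mg; lia.
move: (rcd_ae_const mH rcd mgt gH) gmax; apply: filterS2 => w gconst gmaxw _.
rewrite /F /= !indicE; case: (I w \in B); last first.
  by rewrite !integral0_eq// => v _; rewrite mul0e.
rewrite (eq_integral (fun v => (goodput eps (rstar t (I w)) (gam t%:Z v))%:E)); last first.
  move=> v _; rewrite mul1e YE ger0_norm //.
  exact: (goodput_ge0 hRset eps_range (rstarR _) (gam_ge0 _ _)).
rewrite [leRHS](eq_integral (fun v => (`|goodput eps (c (Z w)) (gam t%:Z v)|)%:E)); last first.
  by move=> v _; rewrite mul1e YE.
apply: le_trans (gmaxw _ (rstarR _)) _.
apply: ae_ge0_le_integral => //.
- by move=> v _; rewrite lee_fin; apply: (goodput_ge0 hRset eps_range).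
- by apply/measurable_EFinP; exact: measurable_goodput.
- apply/measurable_EFinP; apply: measurableT_comp => //.
  by apply: measurable_goodput => //; exact: measurable_cst.
apply: filterS gconst => v gvw _.
by rewrite lee_fin gvw gE ler_norm.
Qed.

Theorem lemma1 (R : realType) (disp : measure_display)
  (Omega : measurableType disp) (P : probability Omega R)
  (d N : nat) (hd : (0 < d)%N)
  (Rset : set R) (hRset : forall r, Rset r -> 0 <= r)
  (eps : R -> R -> R)
  (eps_meas : measurable_fun setT (fun p : R * R => eps p.1 p.2))
  (eps_range : forall r x, Rset r -> 0 <= x -> 0 <= eps r x <= 1)
  (eps_decr : forall r x y, Rset r -> 0 <= x -> x < y -> eps r y < eps r x)
  (gam : int -> Omega -> R)
  (gam_meas : forall t, measurable_fun setT (gam t))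
  (gam_ge0 : forall t w, 0 <= gam t w)
  (past : int -> Omega -> R)
  (past_meas : forall t, t < 0 -> measurable_fun setT (past t))
  (past_adm : forall t w, t < 0 -> Rset (past t w))
  (fb : int -> R -> Omega -> R)
  (fb_meas : forall t,
     measurable_fun setT (fun p : R * Omega => fb t p.1 p.2))
  (rstar rcg : policy)
  (rstar_opt : optimal_allocation eps gam past d fb P Rset N rstar)
  (rcg_opt : optimal_allocation eps gam past d perfect_feedback P Rset N rcg)
  (rcg_snr : function_of_snr eps Rset N rcg)
  (no_info : forall t : nat, (t <= N)%N ->
     cond_indep P (history gam (t%:Z - d%:Z))
       (info eps gam fb (rate eps gam past d fb rstar) (t%:Z - d%:Z))
       (future gam (t%:Z - d%:Z)))
  (rstar_fin : forall t : nat, (t <= N)%N ->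
     P.-integrable setT (fun w =>
       (goodput eps (rate eps gam past d fb rstar t%:Z w) (gam t%:Z w))%:E))
  (rcg_fin : forall t : nat, (t <= N)%N ->
     P.-integrable setT (fun w =>
       (goodput eps (rate eps gam past d perfect_feedback rcg t%:Z w)
          (gam t%:Z w))%:E)) :
  {ae P, forall w,
    cexp P (info eps gam fb past (- d%:Z))
      (fun v => \sum_(0 <= t < N.+1)
         goodput eps (rate eps gam past d fb rstar t%:Z v) (gam t%:Z v)) w
    <= cexp P (info eps gam fb past (- d%:Z))
      (fun v => \sum_(0 <= t < N.+1)
         goodput eps (rate eps gam past d perfect_feedback rcg t%:Z v)
           (gam t%:Z v)) w}.
Proof.
have [rstar_adm rstar_kappa] := rstar_opt; have rcg_adm := proj1 rcg_opt.
set H := info eps gam fb past (- d%:Z).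
have mH : measurable_fun setT H.
  by apply: (measurable_info eps_meas fb_meas gam_meas) => u us; apply: past_meas; lia.
have HE : info eps gam fb (rate eps gam past d fb rstar) (0%N%:Z - d%:Z) = H.
  apply/funext => w; rewrite /H sub0r; apply: info_eq => u us.
  by rewrite rate_lt0//; lia.
(* The recursion at time 0 provides a regular conditional distribution given the initial
   information, hence versions of both conditional expectations. *)
have [kappa [rcd _]] := rstar_kappa rstar rstar_adm 0%N (leq0n _).
have sysE : switch d 0 rstar rstar = rstar.
  by apply/funext => j; rewrite /switch if_same.
rewrite sysE HE in rcd.
have G0 f pol k w : admissible Rset N pol -> (k <= N)%N ->
    0 <= goodput eps (rate eps gam past d f pol k%:Z w) (gam k%:Z w).
  move=> pol_adm kN; apply: (goodput_ge0 hRset eps_range) => //.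
  by apply: (rate_adm _ _ _ hd past_adm w pol_adm); lia.
have sum_cexp f pol : admissible Rset N pol ->
    (forall t : nat, (t <= N)%N -> P.-integrable setT (fun w =>
      (goodput eps (rate eps gam past d f pol t%:Z w) (gam t%:Z w))%:E)) ->
    exists g, is_cexp P H (fun v => \sum_(0 <= t < N.+1)
      goodput eps (rate eps gam past d f pol t%:Z v) (gam t%:Z v)) g.
  move=> pol_adm pol_fin; eexists; apply: (is_cexp_rcd mH rcd) => [|w].
    by apply: integrable_sum_nat => k /andP[_ kN]; exact: pol_fin.
  by rewrite big_nat_cond sumr_ge0// => k /andP[/andP[_ kN] _]; apply: G0.
have [gstar cstar] := sum_cexp _ _ rstar_adm rstar_fin.
have [gcg ccg] := sum_cexp _ _ rcg_adm rcg_fin.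
apply: (cexp_le cstar ccg) => B mB.
under eq_integral do rewrite big_mkord.
under [leRHS]eq_integral do rewrite big_mkord.
apply: le_integral_sum => [|k|k|k w|k w|k].
- exact: measurable_preimage.
- by apply/measurable_EFinP/(measurable_int P)/rstar_fin; rewrite -ltnS.
- by apply/measurable_EFinP/(measurable_int P)/rcg_fin; rewrite -ltnS.
- by apply: G0 => //; rewrite -ltnS.
- by apply: G0 => //; rewrite -ltnS.
(* Events of the initial information are also events of the information up to [k - d], on which the
   terms at time [k] have been compared. *)
have kN : (k <= N)%N by rewrite -ltnS.
have shift : sigma_le H
    (info eps gam fb (rate eps gam past d fb rstar) (k%:Z - d%:Z)).
  apply: sigma_le_info_shift => [|u w ud]; first by lia.
  by rewrite rate_lt0//; lia.
have [B' mB' <-] := shift _ mB.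
exact: (goodput_le_genie hd hRset eps_meas eps_range eps_decr gam_meas gam_ge0
  past_meas past_adm fb_meas rstar_adm rcg_opt rcg_snr rcg_fin kN (no_info k kN)).
Qed.
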